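(* All number fields are considered as subfields of $\mathbb{C}$; for a number field $F$ with ring of integers $\mathcal{O}_F$ let $t_F$ be the positive integer with $T_{F/\mathbb{Q}}(\mathcal{O}_F)=t_F\mathbb{Z}$. (I) Let $L_1,\dots,L_r$ be number fields with $\gcd(\deg L_i,\deg L_j)=1$ for all $1\le i\ne j\le r$ and $t_{L_i}=1$ for all $1\le i\le r$, and let $L=L_1\cdots L_r$ be their compositum. Then $\deg(L)=\prod_{i=1}^r\deg(L_i)$ and $t_L=1$. (II) Let $m_1,\dots,m_r$ be squarefree integers with $m_1\equiv\cdots\equiv m_r\equiv 1\pmod 4$, and let $L$ be the compositum of the quadratic fields $\mathbb{Q}(\sqrt{m_1}),\dots,\mathbb{Q}(\sqrt{m_r})$. Then $t_L=1$. (III) If $K$ and $L$ are number fields that are normal over $\mathbb{Q}$ and satisfy $t_K=t_L=1$, then $t_{KL}=1$, where $KL$ is the compositum.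
   Context: $T_{F/\mathbb{Q}}$ denotes the trace map $F\to\mathbb{Q}$, $\alpha\mapsto\sum\sigma(\alpha)$ over the $[F:\mathbb{Q}]$ embeddings $\sigma:F\to\mathbb{C}$; $\deg(F)=[F:\mathbb{Q}]$. The compositum of subfields of $\mathbb{C}$ is the smallest subfield of $\mathbb{C}$ containing all of them. *)

(* Defs.v *)
(* Number fields are subfields of algC (the algebraic
   closure of Q inside C, i.e. the algebraic complex numbers). *)
From HB Require Import structures.
From mathcomp Require Import all_boot all_order all_algebra all_field.
From Stdlib Require Import ClassicalEpsilon.
Set Implicit Arguments. Unset Strict Implicit. Unset Printing Implicit Defensive.
Import Order.TTheory GRing.Theory Num.Theory.
Local Open Scope ring_scope.

Definition cset := algC -> Prop.

Definition is_subfield (F : cset) : Prop :=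
  [/\ F 0, F 1,
      (forall x y, F x -> F y -> F (x - y)),
      (forall x y, F x -> F y -> F (x * y)) &
      (forall x, F x -> x != 0 -> F x^-1)].

Definition is_Qbasis (F : cset) (b : seq algC) : Prop :=
  [/\ (forall i, (i < size b)%N -> F b`_i),
      (forall c : seq algC, size c = size b -> all (fun q => q \in Crat) c ->
          \sum_(i < size b) c`_i * b`_i = 0 -> all (fun q => q == 0) c) &
      (forall x, F x -> exists c : seq algC,
          [/\ size c = size b, all (fun q => q \in Crat) c &
              x = \sum_(i < size b) c`_i * b`_i])].

Definition is_numfield (F : cset) : Prop :=
  is_subfield F /\ exists b, is_Qbasis F b.

Definition Qbasis (F : cset) : seq algC :=
  epsilon (inhabits [::]) (fun b => is_Qbasis F b).
Definition deg (F : cset) : nat := size (Qbasis F).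

(* field embeddings F -> C (images of a number field lie in algC) *)
Definition is_emb (F : cset) (s : algC -> algC) : Prop :=
  [/\ s 1 = 1,
      (forall x y, F x -> F y -> s (x + y) = s x + s y) &
      (forall x y, F x -> F y -> s (x * y) = s x * s y)].

Definition is_emb_list (F : cset) (s : seq (algC -> algC)) : Prop :=
  [/\ (forall i, (i < size s)%N -> is_emb F (nth id s i)),
      (forall i j, (i < size s)%N -> (j < size s)%N -> i <> j ->
          exists x, F x /\ nth id s i x <> nth id s j x) &
      (forall sg, is_emb F sg -> exists2 i, (i < size s)%N &
          forall x, F x -> sg x = nth id s i x)].

Definition emb_list (F : cset) : seq (algC -> algC) :=
  epsilon (inhabits [::]) (fun s => is_emb_list F s).

Definition trace (F : cset) (a : algC) : algC :=
  \sum_(sg <- emb_list F) sg a.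

Definition ring_of_integers (F : cset) : cset := fun a => F a /\ a \in Aint.

Definition t_is_one (F : cset) : Prop :=
  forall y, (exists a, ring_of_integers F a /\ y = trace F a) <-> y \is a Num.int.

Definition gen_field (S : cset) : cset :=
  fun x => forall K : cset, is_subfield K -> (forall y, S y -> K y) -> K x.

Definition compositum (r : nat) (L : 'I_r -> cset) : cset :=
  gen_field (fun x => exists i, L i x).

Definition compositum2 (K L : cset) : cset := gen_field (fun x => K x \/ L x).

Definition quad_field (m : int) : cset := gen_field (fun x => x = sqrtC m%:~R).

Definition squarefree (m : int) : Prop :=
  forall p : nat, prime p -> ~~ ((p ^ 2)%:Z %| m)%Z.

Definition is_normal (F : cset) : Prop :=
  forall sg, is_emb F sg ->
    (forall x, F x -> F (sg x)) /\ (forall y, F y -> exists2 x, F x & sg x = y).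

(* Main.v *)
(* Embed the number fields at hand in one Galois extension M of Q, with group G,
   and let H_K be the subgroup fixing K.  The embeddings of K are the cosets of
   H_K, so #|H_K| T_K(a) is the sum of g(a) over g in G, and t_K = 1 iff some
   integer a of K satisfies sum_(g in G) g(a) = #|H_K|.  Since H_KL is the
   intersection of H_K and H_L, it suffices to find a in K integral with
   sum_(y in H_L) y(a) = #|H_K :&: H_L|: if b in L has trace 1, then summing first
   over H_L shows that ab has trace 1.
   For coprime degrees H_K H_L = G, and any a in K of trace 1 will do.  If K is
   normal then H_K H_L is a group; take the sum of the conjugates of an element of
   trace 1 over coset representatives of H_K H_L in G.  The field L need not be
   normal, so (II) follows from this by adjoining one square root at a time:
   (1 + sqrt m) / 2 has trace 1. *)
Require Import Defs.
From HB Require Import structures.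
From Stdlib Require Import ClassicalEpsilon FunctionalExtensionality PropExtensionality.
From mathcomp Require Import all_boot all_order all_fingroup all_algebra all_field.
From mathcomp Require Import ring.
Import Order.TTheory GRing.Theory Num.Theory.
Local Open Scope ring_scope.

Set Implicit Arguments. Unset Strict Implicit. Unset Printing Implicit Defensive.

(** * Double sums over finite groups and cosets *)

Section GroupSums.
Variables (gT : finGroupType) (V : nmodType) (f : gT -> V).
Implicit Types A B G N : {group gT}.

(** The factorizations of [x0 y0] in [A * B] are counted by their first factors, which fill the left
    coset of [x0] modulo [A :&: B]. *)
Lemma sum_mulg A B :
  \sum_(x in A) \sum_(y in B) f (x * y)%g
  = (\sum_(z in (A * B)%g) f z) *+ #|A :&: B|.
Proof.
transitivity (\sum_(x in A) \sum_(z in (x *: B)%g) f z).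
  apply: eq_bigr => x _; rewrite [RHS](reindex_inj (mulgI x)) /=.
  by apply: eq_bigl => y; rewrite mem_lcoset mulKg.
rewrite (exchange_big_dep (fun z => z \in (A * B)%g)) /=; last first.
  by move=> x z Ax /lcosetP[y By ->]; apply: mem_mulg.
rewrite -sumrMnl; apply: eq_bigr => z /mulsgP[x0 y0 Ax0 By0 ->].
rewrite -(card_lcoset (A :&: B) x0) -sumr_const; apply: eq_bigl => x.
rewrite !mem_lcoset inE (@groupMl _ A) ?groupV // mulgA (@groupMr _ B y0) //.
by rewrite -[_ \in B]groupV invMg invgK.
Qed.

(** Inverses of right coset representatives represent the left cosets; as left factors they are the
    ones applied first in a product of automorphisms. *)
Lemma sum_rcosetsV G N : N \subset G ->
  \sum_(x in G) f x
  = \sum_(C in rcosets N G) \sum_(u in N) f ((repr C)^-1 * u)%g.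
Proof.
move=> sNG; rewrite (reindex_inj invg_inj) /=.
under eq_bigl do rewrite groupV.
rewrite (set_partition_big _ (rcosets_partition sNG)) /=.
apply: eq_bigr => _ /rcosetsP[x _ ->];
have /rcoset_eqP eqC := mem_repr_rcoset N x; set r := repr _ in eqC *.
rewrite -eqC (reindex_inj (mulIg r)) [RHS](reindex_inj invg_inj) /=.
by apply: eq_big => u; rewrite ?mem_rcoset ?mulgK ?groupV // invMg.
Qed.

End GroupSums.

(** * Trace identities in a finite Galois extension M of Q *)

Section GaloisModel.
Variable M : splittingFieldType rat.
Implicit Types (K L : {subfield M}) (g : gal_of {:M}) (a b : M).
Local Notation H K := 'Gal({:M} / K)%g.
Local Notation G := 'Gal({:M} / 1)%g.

Lemma galME (x y : gal_of {:M}) a : (x * y)%g a = y (x a) :> M.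
Proof. by rewrite galM ?memvf. Qed.

Lemma galois_fullv K : galois K {:M}.
Proof.
rewrite /galois subvf normalFieldf andbT; apply/separableP=> x _.
by apply: pcharf0_separable => p; rewrite (fmorph_pchar (in_alg M)) pchar_num.
Qed.

Lemma gal_fix K g a : g \in H K -> a \in K -> g a = a.
Proof. by move=> Hg; apply: fixed_gal Hg; rewrite subvf. Qed.

Lemma mem_gal K g : {in K, forall a, g a = a} -> g \in H K.
Proof. by move=> gK; rewrite gal_kHom ?subvf //; apply/kAHomP. Qed.

Lemma mem_galQ g : g \in G.
Proof. by apply: mem_gal => _ /vlineP[q ->]; rewrite rmorph_alg. Qed.

Lemma natr_cardG_neq0 (A : {group gal_of {:M}}) : #|A|%:R != 0 :> M.
Proof.
rewrite -(rmorph_nat (in_alg M)) fmorph_eq0 pnatr_eq0 -lt0n; exact: cardG_gt0.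
Qed.

(** In the double sum over [H K] and [A] the factor from [H K] acts first and fixes [a]; comparing
    with [sum_mulg], [#|H K|] cancels. *)
Lemma gal_sum_restrict K (A : {group gal_of {:M}}) a : a \in K ->
    \sum_(z in (H K * A)%g) z a = #|H K|%:R ->
  \sum_(y in A) y a = #|H K :&: A|%:R.
Proof.
move=> Ka tr_a; have := sum_mulg (fun z : gal_of {:M} => z a) 'Gal({:M} / K)%G A.
rewrite /= tr_a -mulrnA mulnC mulrnA => eq_tr.
apply/(mulfI (natr_cardG_neq0 'Gal({:M} / K)%G)); rewrite !mulr_natl /= -eq_tr.
rewrite -sumr_const; apply: eq_bigr => x Hx; apply: eq_bigr => y _.
by rewrite galME (gal_fix Hx).
Qed.

(** Summing over [H L] before [G] counts each automorphism [#|H L|] times. Since [H L] fixes [b],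
    the inner sum is [c] times [b]. *)
Lemma gal_sum_mul L c a b : b \in L ->
    \sum_(y in H L) y a = c%:R -> \sum_(g in G) g b = #|H L|%:R ->
  \sum_(g in G) g (a * b) = c%:R.
Proof.
move=> Lb tr_a tr_b.
have := sum_mulg (fun z : gal_of {:M} => z (a * b))
  'Gal({:M} / L)%G 'Gal({:M} / 1%AS)%G.
have sLG : (H L) \subset G by rewrite galS ?sub1v.
rewrite mulSGid //= (setIidPl sLG) => eq_tr.
apply/(mulIf (natr_cardG_neq0 'Gal({:M} / L)%G)); rewrite mulr_natr -eq_tr.
rewrite exchange_big /= -tr_b mulr_sumr; refine (eq_bigr _ _) => g _.
transitivity (g ((\sum_(y in H L) y a) * b)); last first.
  by rewrite tr_a rmorphM rmorph_nat.
rewrite mulr_suml rmorph_sum; apply: eq_bigr => y Hy.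
by rewrite galME [y _]rmorphM /= (gal_fix Hy Lb).
Qed.

Lemma gal_sum_stable K L a : (forall g, {in K, forall c, g c \in K}) ->
    a \in K -> \sum_(g in G) g a = #|H K|%:R ->
  exists s : seq (gal_of {:M}),
    \sum_(y in H L) y (\sum_(x <- s) x a) = #|H K :&: H L|%:R.
Proof.
move=> stK Ka tr_a; pose B := 'Gal({:M} / L)%G; pose A := 'Gal({:M} / K)%G.
(* By stability [g^-1 c] lies in [K], where [h] is trivial, so the conjugate of [h] by [g] fixes [c]
   too. *)
have nAB : B \subset 'N(A)%g.
  apply/subsetP=> g _; rewrite inE; apply/subsetP=> _ /imsetP[h Hh ->].
  apply: mem_gal => c Kc; rewrite conjgE !galME (gal_fix Hh) ?stK //.
  by rewrite -galME mulVg gal_id.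
pose N := (A <*> B)%G.
have sNG : N \subset 'Gal({:M} / 1%AS)%G.
  by apply/subsetP=> g _; apply: mem_galQ.
(* These representatives act on [a] first and keep it in [K]; the sum over [N = H K * H L] is then
   taken of their total. *)
exists [seq (repr C)^-1%g | C <- enum (rcosets N G)].
rewrite big_map big_enum /=.
apply: (@gal_sum_restrict K B); first by apply: rpred_sum => C _; apply: stK.
have := sum_rcosetsV (fun z : gal_of {:M} => z a) sNG.
rewrite /= tr_a => ->; rewrite exchange_big /= norm_joinEr //.
apply: eq_bigr => u _; rewrite rmorph_sum /=.
by under [RHS]eq_bigr do rewrite galME.
Qed.

(** * Images of subfields of M in C, and their degrees *)

Variable iota : {rmorphism M -> algC}.

Definition img (K : {vspace M}) : cset :=
  fun x => exists2 y, y \in K & iota y = x.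

Lemma is_subfield_img K : is_subfield (img K).
Proof.
split; first by exists 0; rewrite ?rmorph0 ?mem0v.
- by exists 1; rewrite ?rmorph1 ?mem1v.
- by move=> _ _ [x Kx <-] [y Ky <-]; exists (x - y); rewrite ?rmorphB ?rpredB.
- by move=> _ _ [x Kx <-] [y Ky <-]; exists (x * y); rewrite ?rmorphM ?rpredM.
by move=> _ [x Kx <-] _; exists x^-1; rewrite ?fmorphV ?rpredV.
Qed.

Lemma img_lift K (s : seq algC) : (forall x, x \in s -> img K x) ->
  exists2 s' : seq M, map iota s' = s & {subset s' <= K}.
Proof.
elim: s => [|x s IH] Ks; first by exists [::].
have [y Ky eq_y] := Ks x (mem_head _ _).
have [z sz|s' eq_s Ks'] := IH; first by apply: Ks; rewrite inE sz orbT.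
exists (y :: s'); first by rewrite /= eq_y eq_s.
by move=> z; rewrite inE => /predU1P[->|/Ks'].
Qed.

Lemma iota_comb (c : seq rat) (s : seq M) :
  iota (\sum_(i < size s) c`_i *: s`_i)
  = \sum_(i < size s) (map ratr c : seq algC)`_i * (map iota s)`_i.
Proof.
rewrite rmorph_sum; apply: eq_bigr => i _.
rewrite /= rmorphZ_num [(map iota s)`_i](nth_map 0) //.
(* Past the end of [c] both default coefficients are 0. *)
have [lt_i|ge_i] := ltnP i (size c); first by rewrite (nth_map 0).
have ratr0 : ratr 0 = 0 :> algC by exact: rmorph0.
rewrite (nth_default 0 ge_i) [X in _ = X * _]nth_default ?size_map //. by rewrite ratr0.
Qed.

Lemma Crat_lift (c : seq algC) : all (fun q => q \in Crat) c ->
  exists c' : seq rat, map ratr c' = c.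
Proof.
elim: c => [|q c IH] /= => [_|/andP[/CratP[a ->] /IH[c' <-]]]; first by exists [::].
by exists (a :: c').
Qed.

Lemma is_Qbasis_img K (s : seq M) : basis_of K s ->
  is_Qbasis (img K) (map iota s).
Proof.
move=> bas_s; split.
- move=> i; rewrite size_map => lt_i; rewrite (nth_map 0) //.
  by exists s`_i; rewrite // (basis_mem bas_s) ?mem_nth.
- move=> c; rewrite size_map => sz_c /Crat_lift[c' eq_c].
  rewrite -eq_c -iota_comb => /eqP; rewrite fmorph_eq0 => /eqP c0.
  have /freeP/(_ (fun i => c'`_i) c0) fr : free (in_tuple s) := basis_free bas_s.
  apply/allP=> _ /mapP[q /(nthP 0)[i lt_i <-] ->].
  rewrite -sz_c -eq_c size_map in fr.
  by rewrite (fr (Ordinal lt_i)) rmorph0.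
move=> _ [y Ky <-]; have := Ky; rewrite -(span_basis bas_s) => sy.
have /coord_span eq_y : y \in <<in_tuple s>>%VS by [].
pose c := [seq coord (in_tuple s) i y | i <- enum 'I_(size s)].
have sz_c : size c = size s by rewrite size_map size_enum_ord.
exists (map ratr c); split; first by rewrite size_map sz_c size_map.
  by apply/allP=> _ /mapP[q _ ->]; apply: Crat_rat.
rewrite size_map -iota_comb {1}eq_y; congr (iota _); apply: eq_bigr => i _.
by rewrite (nth_map i) ?size_enum_ord // nth_ord_enum.
Qed.

(** [deg] selects a basis by [epsilon], so an arbitrary basis has to be handled: its lift to [M] is
    a basis of [K]. *)
Lemma size_Qbasis_img K (b : seq algC) : is_Qbasis (img K) b -> size b = \dim K.
Proof.
case=> Kb free_b span_b.
have [x /(nthP 0)[i lt_i <-]|s eq_s Ks] := @img_lift K b; first exact: Kb.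
subst b; have sz_s := size_map iota s.
suffices /size_basis eq_dim : basis_of K (in_tuple s) by rewrite sz_s eq_dim.
suffices [fr sX Xs] : [/\ free (in_tuple s), {subset s <= K} & (K <= <<s>>)%VS].
  by rewrite /basis_of eqEsubv Xs fr !andbT; apply/span_subvP.
split=> //.
- apply/freeP=> k k0 i; pose c := [seq k j | j <- enum 'I_(size s)].
  have sz_c : size c = size s by rewrite size_map size_enum_ord.
  have nth_c (j : 'I_(size s)) : c`_j = k j.
    by rewrite (nth_map j) ?size_enum_ord // nth_ord_enum.
  have /allP/(_ (ratr (k i))) : all (fun q => q == 0) (map (ratr : rat -> algC) c).
    apply: free_b; first by rewrite size_map sz_c size_map.
      by apply/allP=> _ /mapP[q _ ->]; apply: Crat_rat.
    rewrite size_map -iota_comb.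
    apply: etrans (rmorph0 iota); congr (iota _); apply: etrans k0.
    by apply: eq_bigr => j _; rewrite nth_c.
  rewrite !map_f ?mem_enum // => /(_ isT).
  by rewrite fmorph_eq0 => /eqP.
- apply/subvP=> y Ky; have [|c [sz_c /Crat_lift[c' eq_c]]] := span_b (iota y).
    by exists y.
  rewrite -eq_c size_map -iota_comb => /fmorph_inj ->.
  by apply: memv_suml => i _; rewrite memvZ // memv_span ?mem_nth.
Qed.

Lemma deg_img K : deg (img K) = \dim K.
Proof.
apply: size_Qbasis_img; apply: epsilon_spec.
by exists (map iota (vbasis K)); apply: is_Qbasis_img (vbasisP K).
Qed.

Lemma is_numfield_img K : is_numfield (img K).
Proof.
split; first exact: is_subfield_img.
by exists (map iota (vbasis K)); apply: is_Qbasis_img (vbasisP K).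
Qed.

(** * Complex embeddings, Galois cosets and traces *)

Lemma horner_rat (L : fieldExtType rat) (f : {rmorphism L -> algC}) p x :
  f (map_poly (in_alg L) p).[x] = (map_poly ratr p).[f x].
Proof.
rewrite -horner_map -map_poly_comp; congr _.[_]; apply: eq_map_poly => q.
by rewrite /= alg_num_field fmorph_rat.
Qed.

(** A primitive element [z] of [K] goes to a root of its minimal polynomial; this splits in [M], and
    some Galois automorphism sends [z] to the same root. *)
Lemma emb_img K (sg : algC -> algC) : is_emb (img K) sg ->
  exists g : gal_of {:M}, {in K, forall y, sg (iota y) = iota (g y)}.
Proof.
(* [sg] respects the operations only on the image of [K]; on the type [subvs_of K] it becomes a
   genuine ring morphism [fr]. *)
case=> sg1 sgD sgM; pose f (u : subvs_of K) := sg (iota (vsval u)).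
have imK (u : subvs_of K) : img K (iota (vsval u)) by exists (vsval u); rewrite ?subvsP.
have fB : zmod_morphism f.
  move=> u v; apply/eqP; rewrite eq_sym subr_eq -sgD //; apply/eqP.
  by rewrite /f -rmorphD /= subrK.
have fM : monoid_morphism f.
  by split=> [|u v]; rewrite /f ?rmorph1 // rmorphM sgM.
pose fBm := GRing.isZmodMorphism.Build _ _ f fB.
pose fMm := GRing.isMonoidMorphism.Build _ _ f fM.
pose fr : {rmorphism subvs_of K -> algC} := HB.pack f fBm fMm.
pose z := separable_generator 1%AS K.
have defK : K = <<1; z>>%VS :> {vspace M}.
  apply: eq_adjoin_separable_generator; last exact: sub1v.
  by apply: separableSr (subvf K) _; case/and3P: (galois_fullv 1%AS).
have Kz : z \in K by rewrite defK memv_adjoin.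
have /polyOver1P[p0 def_p0] := minPolyOver 1%AS z.
have [r def_r] := splitting_field_normal 1%AS z.
have rz : root (map_poly ratr p0) (fr (vsproj K z)).
  rewrite /root -horner_rat.
  suff -> : (map_poly (in_alg (subvs_of K)) p0).[vsproj K z] = 0 by rewrite rmorph0.
  apply: val_inj; rewrite -horner_map /= vsprojK // -map_poly_comp.
  have /rootP := root_minPoly 1%AS z; rewrite def_p0 => <-; congr _.[_].
  by apply: eq_map_poly => q /=; rewrite !algid1.
have : root (map_poly iota (map_poly (in_alg M) p0)) (fr (vsproj K z)).
  rewrite -map_poly_comp (@eq_map_poly _ _ _ ratr) // => q.
  by rewrite /= alg_num_field fmorph_rat.
rewrite -def_p0 (eqP def_r) rmorph_prod /=.
under eq_bigr do rewrite map_polyXsubC.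
rewrite -(big_map iota xpredT (fun w => 'X - w%:P)) root_prod_XsubC.
case/mapP=> w rw eq_w.
have [||||g _ gz] := @normalField_root_minPoly _ _ 1%AS {:M}%AS z w.
- exact: subvf.
- exact: normalFieldf.
- exact: memvf.
- by rewrite (eqP def_r) root_prod_XsubC.
have val_horner p : vsval (map_poly (in_alg (subvs_of K)) p).[vsproj K z]
    = (map_poly (in_alg M) p).[z].
  rewrite -horner_map /= vsprojK // -map_poly_comp; congr _.[_].
  by apply: eq_map_poly => q /=; rewrite !algid1.
exists g => y; rewrite {1}defK => /Fadjoin1_polyP[p ->].
rewrite -val_horner -[LHS]/(fr _) horner_rat [fr _]eq_w -gz.
by rewrite val_horner; apply/esym/(horner_rat (iota \o g)).
Qed.

(** An extension to [algC] restricts to an embedding of every subfield and preserves algebraic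
    integers. *)
Lemma gal_lift (g : gal_of {:M}) :
  exists nu : {rmorphism algC -> algC}, {morph iota : x / g x >-> nu x}.
Proof. by have [nu nu_g] := extend_algC_subfield_aut iota g; exists nu. Qed.

Lemma is_emb_rmorph F (nu : {rmorphism algC -> algC}) : is_emb F nu.
Proof. by split=> *; rewrite ?rmorph1 ?rmorphD ?rmorphM. Qed.

Lemma mem_rcoset_gal K g h :
  (g \in H K :* h)%g <-> {in K, forall y, g y = h y}.
Proof.
split=> [/rcosetP[k Hk ->] y Ky|eq_gh]; first by rewrite galME (gal_fix Hk).
rewrite mem_rcoset; apply: mem_gal => y Ky.
by rewrite galME eq_gh // -galME mulgV gal_id.
Qed.

(** The [epsilon] in [emb_list] needs a witness: extend to [algC] one representative of each coset
    of [H K]. *)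
Lemma emb_list_img K : is_emb_list (img K) (emb_list (img K)).
Proof.
apply: epsilon_spec.
have [nu nuP] : exists nu : gal_of {:M} -> {rmorphism algC -> algC},
    forall g x, iota (g x) = nu g (iota x).
  exists (fun g => sval (constructive_indefinite_description _ (gal_lift g))).
  by move=> g x; case: constructive_indefinite_description.
pose cosets := enum (rcosets (H K) G).
exists [seq nu (repr C) : algC -> algC | C <- cosets].
have sz := size_map (fun C => nu (repr C) : algC -> algC) cosets.
have cosetP i : (i < size cosets)%N -> exists g, nth set0 cosets i = (H K :* g)%g.
  move=> lt_i; have := mem_nth set0 lt_i; rewrite mem_enum => /rcosetsP[g _ ->].
  by exists g.
have repr_coset g : {in K, forall y, repr (H K :* g)%g y = g y}.
  exact/mem_rcoset_gal/mem_repr_rcoset.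
split; rewrite ?sz.
- by move=> i lt_i; rewrite (nth_map set0) //; apply: is_emb_rmorph.
- move=> i j lt_i lt_j neq_ij; rewrite !(nth_map set0) //.
  apply: NNPP => same; apply: neq_ij; apply/eqP.
  rewrite -(nth_uniq set0 lt_i lt_j) ?enum_uniq //; apply/eqP.
  have [[g eq_g] [h eq_h]] := (cosetP i lt_i, cosetP j lt_j).
  rewrite eq_g eq_h in same *; apply/rcoset_eqP/mem_rcoset_gal => y Ky.
  apply: (fmorph_inj iota); apply: NNPP => neq; apply: same.
  exists (iota y); split; first by exists y.
  by rewrite -!nuP !repr_coset.
move=> sg /emb_img[g eq_g].
have cg : (H K :* g)%g \in cosets by rewrite mem_enum -rcosetE imset_f ?mem_galQ.
exists (index (H K :* g)%g cosets) => [|_ [y Ky <-]]; first by rewrite index_mem.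
by rewrite (nth_map set0) ?index_mem // nth_index // -nuP repr_coset ?eq_g.
Qed.

(** Each entry of the chosen list agrees on [K] with some automorphism [e i]. Sending [g] to the
    entry it restricts to partitions [G] into the cosets of the [e i]. *)
Lemma trace_img K y : y \in K ->
  trace (img K) (iota y) *+ #|H K| = iota (\sum_(g in G) g y).
Proof.
move=> Ky; have [emb_s neq_s s_emb] := emb_list_img K.
rewrite /trace; set s := emb_list _ in emb_s neq_s s_emb *.
have /fin_all_exists[e eP] (i : 'I_(size s)) :=
  emb_img (emb_s i (ltn_ord i)).
have /fin_all_exists[k kP] (g : gal_of {:M}) :
    exists i, (g \in H K :* e i)%g.
  have [nu nu_g] := gal_lift g.
  have [i lt_i eq_i] := s_emb _ (is_emb_rmorph (img K) nu).
  exists (Ordinal lt_i); apply/mem_rcoset_gal => x Kx; apply: (fmorph_inj iota).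
  by rewrite nu_g eq_i -?eP //; exists x.
have kE g i : (k g == i) = (g \in H K :* e i)%g.
  apply/eqP/idP=> [<-|/mem_rcoset_gal eq_g]; first exact: kP.
  have /mem_rcoset_gal eq_k := kP g.
  apply: val_inj; apply: NNPP => neq.
  have [_ [[x Kx <-]]] := neq_s _ _ (ltn_ord _) (ltn_ord _) neq.
  by rewrite !eP // -eq_k // eq_g.
rewrite (partition_big k xpredT) //= rmorph_sum (big_nth id) big_mkord -sumrMnl.
apply: eq_bigr => i _; rewrite rmorph_sum eP // -(card_rcoset (H K) (e i)).
rewrite -sumr_const; apply: eq_big => g; first by rewrite mem_galQ kE.
by move/mem_rcoset_gal => ->.
Qed.

(** The trace is rational because its multiple by [#|H K|] is fixed by [G], and integral as a sum of
    conjugates of an integer. *)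
Lemma int_trace_img K y : y \in K -> iota y \in Aint ->
  trace (img K) (iota y) \in Num.int.
Proof.
move=> Ky Ay; have [emb_s _ _] := emb_list_img K.
have HK0 : #|H K|%:R != 0 :> algC by rewrite pnatr_eq0 -lt0n cardG_gt0.
apply: Cint_rat_Aint.
  rewrite -(mulfK HK0 (trace _ _)) mulr_natr trace_img // rpred_div ?rpred_nat //.
  have : \sum_(g in G) g y \in fixedField 'Gal({:M} / 1%AS)%g.
    by apply: galTrace_fixedField; rewrite memvf.
  rewrite (galois_fixedField (galois_fullv 1%AS)) => /vlineP[q ->].
  by rewrite alg_num_field fmorph_rat Crat_rat.
rewrite /trace (big_nth id) big_mkord rpred_sum // => i _.
have [g eq_g] := emb_img (emb_s i (ltn_ord i)).
by rewrite eq_g //; have [nu ->] := gal_lift g; rewrite Aint_aut.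
Qed.

(** Traces of integers form a subgroup of Z, which is everything once it contains 1: [a *~ n] has
    trace [n]. *)
Lemma t_is_one_img K : t_is_one (img K) <->
  exists a, [/\ a \in K, iota a \in Aint & \sum_(g in G) g a = #|H K|%:R].
Proof.
have HK0 : #|H K|%:R != 0 :> algC by rewrite pnatr_eq0 -lt0n cardG_gt0.
split=> [t1|[a [Ka Aa tr_a]] y].
  have [_ [[[a Ka <-] Aa] eq1]] := (t1 1).2 (rpred1 _).
  exists a; split=> //; apply: (fmorph_inj iota).
  by rewrite -(trace_img Ka) // -eq1 rmorph_nat.
split=> [[_ [[[c Kc <-] Ac] ->]]|/intrP[n ->]]; first exact: int_trace_img.
exists (iota (a *~ n)); split.
  by split; [exists (a *~ n); rewrite ?rpredMz | rewrite rmorphMz rpredMz].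
apply: (mulIf HK0); rewrite !mulr_natr trace_img ?rpredMz //.
under eq_bigr do rewrite rmorphMz.
by rewrite -mulrz_suml tr_a rmorphMz rmorph_nat -[RHS]mulrzl mulr_natr.
Qed.

(** * Composita of two subfields of M *)

Lemma dim_gal K : (\dim K * #|H K|)%N = #|G|.
Proof.
have dimE (E : {subfield M}) : (\dim E * #|H E|)%N = \dim {:M}.
  by rewrite -galois_dim ?galois_fullv // mulnC divnK // field_dimS ?subvf.
by rewrite dimE -(dimE 1%AS) dimv1 mul1n.
Qed.

Lemma gal_subG K : H K \subset G.
Proof. by rewrite galS ?sub1v. Qed.

Lemma index_gal K : #|G : H K|%g = \dim K.
Proof. by rewrite -divgS ?gal_subG //= -(dim_gal K) mulnK ?cardG_gt0. Qed.

Lemma gal_prodv K L : H (K * L)%AS = H K :&: H L.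
Proof.
apply/setP=> g; rewrite inE; apply/idP/andP=> [Hg|[HKg HLg]].
  split; apply: mem_gal => y Ky; apply: (gal_fix Hg) => /=.
    by rewrite -[y]mulr1 memv_mul ?mem1v.
  by rewrite -[y]mul1r memv_mul ?mem1v.
(* The elements fixed by this single [g] form a field containing all products. *)
have sKL : (K * L <= fixedField [set g])%VS.
  apply/prodvP=> u v Ku Lv; apply/fixedFieldP=> [|h]; first exact: memvf.
  by rewrite inE => /eqP ->; rewrite rmorphM /= (gal_fix HKg) ?(gal_fix HLg).
apply: mem_gal => y /(subvP sKL)/mem_fixedFieldP[_]; apply.
by rewrite inE.
Qed.

(** Subgroups of coprime index have product [G]; counting orders gives the degree, and
    [gal_sum_restrict] applies to [a] itself. *)
Lemma t_is_one_img_coprime K L : coprime (\dim K) (\dim L) ->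
    t_is_one (img K) -> t_is_one (img L) ->
  \dim (K * L)%AS = (\dim K * \dim L)%N /\ t_is_one (img (K * L)%AS).
Proof.
move=> coKL /t_is_one_img[a [Ka Aa tr_a]] /t_is_one_img[b [Lb Ab tr_b]].
have mulG : ('Gal({:M} / K) * 'Gal({:M} / L))%g = G.
  apply: (coprime_index_mulG (G := 'Gal({:M} / 1)%G)); rewrite ?gal_subG //.
  by rewrite !index_gal.
split.
  have := mul_cardG 'Gal({:M} / K)%G 'Gal({:M} / L)%G.
  rewrite /= mulG -gal_prodv => eq_card.
  apply/eqP; rewrite -(eqn_pmul2r (_ : 0 < #|H K| * #|H L|)%N); last first.
    by rewrite muln_gt0 !cardG_gt0.
  by rewrite mulnACA !dim_gal eq_card mulnCA dim_gal.
apply/t_is_one_img; exists (a * b); split.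
- by rewrite memv_mul.
- by rewrite rmorphM rpredM.
rewrite gal_prodv; apply: (gal_sum_mul Lb) => //.
by apply: (@gal_sum_restrict _ 'Gal({:M} / L)%G); rewrite //= mulG.
Qed.

(** The sum from [gal_sum_stable] takes the role of [a]: stability keeps it in [K], and conjugates
    of integers are integers. *)
Lemma t_is_one_img_stable K L : (forall g, {in K, forall c, g c \in K}) ->
    t_is_one (img K) -> t_is_one (img L) -> t_is_one (img (K * L)%AS).
Proof.
move=> stK /t_is_one_img[a [Ka Aa tr_a]] /t_is_one_img[b [Lb Ab tr_b]].
have [s tr_s] := gal_sum_stable L stK Ka tr_a.
apply/t_is_one_img; exists ((\sum_(x <- s) x a) * b); split.
- by rewrite memv_mul // rpred_sum // => x _; apply: stK.
- rewrite rmorphM rpredM // rmorph_sum rpred_sum // => x _.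
  by have [nu ->] := gal_lift x; rewrite Aint_aut.
by rewrite gal_prodv; apply: (gal_sum_mul Lb).
Qed.

End GaloisModel.

(** Equality, rather than equivalence, allows rewriting under the [epsilon] of [deg] and [trace]. *)
Lemma cset_eq (F F' : cset) : (forall x, F x <-> F' x) -> F = F'.
Proof.
move=> eqF; apply: functional_extensionality => x.
exact/propositional_extensionality/eqF.
Qed.

(** * Subfields of C and generated fields *)

Section Subfields.
Variable F : cset.
Hypothesis subF : is_subfield F.

Lemma subfieldN x : F x -> F (- x).
Proof. by case: subF => F0 _ FB _ _ Fx; rewrite -sub0r; apply: FB. Qed.

Lemma subfieldD x y : F x -> F y -> F (x + y).
Proof.
by move=> Fx Fy; rewrite -[y]opprK; case: subF => _ _ FB _ _; apply/FB/subfieldN.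
Qed.

Lemma subfield_sum (I : Type) (r : seq I) (f : I -> algC) :
  (forall i, F (f i)) -> F (\sum_(i <- r) f i).
Proof.
move=> Ff; apply: big_ind => [|x y|i _]; last exact: Ff.
  by case: subF.
exact: subfieldD.
Qed.

Lemma subfield_nat n : F n%:R.
Proof.
case: subF => F0 F1 _ _ _; elim: n => [//|n IH].
by rewrite -natr1; apply: subfieldD.
Qed.

Lemma subfield_int (n : int) : F n%:~R.
Proof.
case: n => n; first exact: subfield_nat.
by rewrite NegzE rmorphN /=; apply/subfieldN/subfield_nat.
Qed.

Lemma subfield_rat q : F (ratr q).
Proof.
case: subF => _ _ _ FM FV; apply: FM; first exact: subfield_int.
by apply: FV; [apply: subfield_int | rewrite intr_eq0 denq_neq0].
Qed.

Lemma subfieldX x n : F x -> F (x ^+ n).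
Proof.
case: subF => _ F1 _ FM _ Fx; elim: n => [//|n IH].
by rewrite exprS; apply: FM.
Qed.

End Subfields.

Section GeneratedFields.
Variable S : cset.

Lemma is_subfield_gen : is_subfield (gen_field S).
Proof.
split=> [F [//]|F [//]|x y Fx Fy F subF SF|x y Fx Fy F subF SF|x Fx nz F subF SF].
- by have [_ _ FB _ _] := subF; apply: FB; [apply: Fx | apply: Fy].
- by have [_ _ _ FM _] := subF; apply: FM; [apply: Fx | apply: Fy].
by have [_ _ _ _ FV] := subF; apply: FV => //; apply: Fx.
Qed.

Lemma mem_gen_field x : S x -> gen_field S x.
Proof. by move=> Sx F _; apply. Qed.

End GeneratedFields.

(** * Generated fields and composita as images from M *)

Section Model.
Variables (M : splittingFieldType rat) (iota : {rmorphism M -> algC}).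

Lemma subfield_adjoin_seq F (s : seq M) : is_subfield F ->
  {in s, forall y, F (iota y)} -> {in <<1 & s>>%VS, forall y, F (iota y)}.
Proof.
move=> subF; elim/last_ind: s => [|s x IH] Fs y.
  rewrite Fadjoin_nil => /vlineP[q ->].
  by rewrite rmorphZ_num rmorph1 mulr1; apply: subfield_rat.
rewrite adjoin_rcons => /Fadjoin_polyP[p sp ->].
rewrite horner_coef rmorph_sum; apply: subfield_sum => // i.
rewrite rmorphM rmorphXn; case: (subF) => _ _ _ FM _; apply: FM.
  apply: IH; last exact/(polyOverP sp).
  by move=> z sz; apply: Fs; rewrite mem_rcons inE sz orbT.
by apply: subfieldX => //; apply: Fs; rewrite mem_rcons mem_head.
Qed.

Lemma gen_field_img (s : seq M) :
  gen_field (fun x => x \in map iota s) = img iota <<1 & s>>.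
Proof.
apply: cset_eq => x; split.
  move=> gx; apply: gx; first exact: (is_subfield_img iota <<1 & s>>%AS).
  by move=> _ /mapP[y sy ->]; exists y => //; apply: seqv_sub_adjoin.
case=> y sy <- F subF SF; apply: subfield_adjoin_seq sy => // z sz.
by apply: SF; apply: map_f.
Qed.

Lemma compositum2_img (K L : {subfield M}) :
  compositum2 (img iota K) (img iota L) = img iota (K * L)%AS.
Proof.
apply: cset_eq => x; split.
  move=> gx; apply: gx; first exact: is_subfield_img.
  move=> _ [] [y Ky <-]; exists y => //=.
    by rewrite -[y]mulr1 memv_mul ?mem1v.
  by rewrite -[y]mul1r memv_mul ?mem1v.
case=> y /= KLy <- F subF SF; have [_ _ _ FM _] := subF.
(* By definition [K * L] is spanned by products of basis vectors, so [y] is a rational combination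
   of such products. *)
move: KLy; rewrite /prodv locked_withE => KLy.
rewrite (coord_span (X := in_tuple (allpairs _ _ _)) KLy).
rewrite rmorph_sum; apply: subfield_sum => // i.
rewrite rmorphZ_num; apply: (FM); first exact: subfield_rat.
have /allpairsP[[u v] /= [Ku Lv ->]] := mem_nth 0 (ltn_ord i).
rewrite rmorphM; apply: FM; apply: (SF); [left; exists u | right; exists v] => //.
  exact: vbasis_mem Ku.
exact: vbasis_mem Lv.
Qed.

Lemma numfield_img F (b : seq M) : is_subfield F -> is_Qbasis F (map iota b) ->
  F = img iota <<1 & b>>.
Proof.
move=> subF [Fb _ span_b]; apply: cset_eq => x; split.
  case/span_b => c [_ /Crat_lift[c' <-] ->].
  rewrite size_map -iota_comb; eexists; last by [].
  by apply: memv_suml => i _; rewrite memvZ // seqv_sub_adjoin ?mem_nth.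
case=> y sy <-; apply: subfield_adjoin_seq sy => // z /(nthP 0)[i lt_i <-].
by have := Fb i; rewrite size_map (nth_map 0) //; apply.
Qed.

End Model.

(** * Placing number fields in a common splitting field *)

Lemma splitting_model (s : seq algC) :
  exists (M : splittingFieldType rat) (iota : {rmorphism M -> algC}) (s' : seq M),
    map iota s' = s.
Proof.
(* [P] is the product of the minimal polynomials of the elements of [s]. *)
have [P P_neq0 Ps] : exists2 P : {poly rat}, P != 0
    & {in s, forall x, root (map_poly ratr P) x}.
  elim: s => [|x s [P nzP Ps]]; first by exists 1; rewrite ?oner_neq0.
  have [p [_ mon_p] dv_p] := minCpolyP x.
  exists (p * P); first by rewrite mulf_neq0 // monic_neq0.
  move=> y; rewrite inE rmorphM rootM => /predU1P[->|/Ps ->]; last by rewrite orbT.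
  by rewrite dv_p dvdpp.
have [rs def_rs] := closed_field_poly_normal (map_poly ratr P : {poly algC}).
(* [Qs] is generated by all complex roots of [P], so it is a splitting field, and [s] lifts to
   it. *)
have [Qs [QsC [s1 def_s1 gen_s1]]] := num_field_exists rs.
have split_Qs : SplittingField.axiom Qs.
  exists (map_poly (in_alg Qs) P); first exact: alg_polyOver.
  exists s1 => //; rewrite -(eqp_map QsC).
  have -> : map_poly QsC (map_poly (in_alg Qs) P) = map_poly ratr P.
    rewrite -map_poly_comp; apply: eq_map_poly => q.
    by rewrite /= rmorphZ_num rmorph1 mulr1.
  rewrite def_rs -def_s1 big_map rmorph_prod /=.
  under [X in _ %= X]eq_bigr do rewrite map_polyXsubC.
  by rewrite eqp_scale // lead_coef_eq0 map_poly_eq0.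
pose Mmix := FieldExt_isSplittingField.Build rat Qs split_Qs.
pose M : splittingFieldType rat := HB.pack Qs Mmix.
exists M, QsC.
suff [s' Es'] : exists s' : seq Qs, map QsC s' = s by exists s'.
elim: s Ps => [|x s IH] Ps; first by exists [::].
have [y sy|s' <-] := IH; first by apply: Ps; rewrite inE sy orbT.
have := Ps x (mem_head _ _); rewrite def_rs rootZ ?root_prod_XsubC; last first.
  by rewrite lead_coef_eq0 map_poly_eq0.
by rewrite -def_s1 => /mapP[z _ ->]; exists (z :: s').
Qed.

(** Lifting the concatenation of two bases puts both fields in the same [M]. *)
Lemma numfields_model (F F' : cset) : is_numfield F -> is_numfield F' ->
  exists (M : splittingFieldType rat) (iota : {rmorphism M -> algC})
    (K K' : {subfield M}), F = img iota K /\ F' = img iota K'.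
Proof.
move=> [subF [b basF]] [subF' [b' basF']].
have [M [iota [s eq_s]]] := splitting_model (b ++ b').
exists M, iota, <<1 & take (size b) s>>%AS, <<1 & drop (size b) s>>%AS.
split; apply: numfield_img => //.
  by rewrite map_take eq_s take_size_cat.
by rewrite map_drop eq_s drop_size_cat.
Qed.

Lemma is_numfield_compositum2 F F' :
  is_numfield F -> is_numfield F' -> is_numfield (compositum2 F F').
Proof.
move=> nF nF'; have [M [iota [K [K' [-> ->]]]]] := numfields_model nF nF'.
by rewrite compositum2_img; apply: is_numfield_img.
Qed.

Lemma compositum2_coprime F F' : is_numfield F -> is_numfield F' ->
    coprime (deg F) (deg F') -> t_is_one F -> t_is_one F' ->
  deg (compositum2 F F') = (deg F * deg F')%N /\ t_is_one (compositum2 F F').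
Proof.
move=> nF nF'; have [M [iota [K [K' [-> ->]]]]] := numfields_model nF nF'.
by rewrite compositum2_img !deg_img; apply: t_is_one_img_coprime.
Qed.

(** A form of normality that refers to no model [M]; [gal_lift] carries it to the Galois
    automorphisms of any [M]. *)
Definition aut_stable (F : cset) :=
  forall (nu : {rmorphism algC -> algC}) x, F x -> F (nu x).

Lemma t_is_one_compositum2 F F' : is_numfield F -> is_numfield F' ->
  aut_stable F -> t_is_one F -> t_is_one F' -> t_is_one (compositum2 F F').
Proof.
move=> nF nF'; have [M [iota [K [K' [-> ->]]]]] := numfields_model nF nF'.
move=> stF; rewrite compositum2_img; apply: t_is_one_img_stable => g y Ky.
have [nu nu_g] := gal_lift iota g.
have [|z Kz] := stF nu (iota y); first by exists y.
by rewrite -nu_g => /fmorph_inj <-.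
Qed.

(** * Composita of finite families *)

Lemma compositumS r (L : 'I_r.+1 -> cset) :
  compositum L = compositum2 (L ord0) (compositum (fun i => L (lift ord0 i))).
Proof.
apply: cset_eq => x; split=> gx; apply: gx.
- exact: is_subfield_gen.
- move=> y [i]; case: (unliftP ord0 i) => [j|] -> Ly; apply: mem_gen_field.
    by right; apply: mem_gen_field; exists j.
  by left.
- exact: is_subfield_gen.
move=> y [Ly|gy]; first by apply: mem_gen_field; exists ord0.
apply: gy; first exact: is_subfield_gen.
by move=> z [j Lz]; apply: mem_gen_field; exists (lift ord0 j).
Qed.

(** The empty compositum is Q, where 1 has trace 1. *)
Lemma compositum0 (L : 'I_0 -> cset) :
  [/\ is_numfield (compositum L), deg (compositum L) = 1%N & t_is_one (compositum L)].
Proof.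
have [M [iota _]] := splitting_model [::].
have -> : compositum L = img iota 1%AS.
  rewrite -[RHS]/(img iota 1%VS) -(Fadjoin_nil 1%AS) -gen_field_img.
  apply: cset_eq => x; split=> gx F subF SF; apply: gx => //.
  by move=> y [[]].
split; first exact: is_numfield_img.
  by rewrite deg_img dimv1.
apply/t_is_one_img; exists 1; split; rewrite ?mem1v ?rmorph1 //.
by rewrite -sumr_const; apply: eq_bigr => g _; rewrite rmorph1.
Qed.

(** The induction carries the degree formula along, since it makes the degree of the first field
    coprime to that of the remaining compositum. *)
Lemma t_is_one_compositum_coprime r (L : 'I_r -> cset) :
    (forall i, is_numfield (L i)) ->
    (forall i j, i != j -> coprime (deg (L i)) (deg (L j))) ->
    (forall i, t_is_one (L i)) ->
  [/\ is_numfield (compositum L), deg (compositum L) = (\prod_(i < r) deg (L i))%N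
    & t_is_one (compositum L)].
Proof.
elim: r L => [|r IH] L nL coL tL; first by rewrite big_ord0; apply: compositum0.
have [|||nC degC tC] := IH (fun i => L (lift ord0 i)) => //.
  by move=> i j neq_ij; apply: coL; rewrite (inj_eq lift_inj).
have coC : coprime (deg (L ord0)) (deg (compositum (fun i => L (lift ord0 i)))).
  rewrite degC; apply: (big_ind (coprime _)) => [|a b coa cob|i _].
  - exact: coprimen1.
  - by rewrite coprimeMr coa.
  by apply: coL.
rewrite compositumS big_ord_recl -degC.
have [] := compositum2_coprime (nL ord0) nC coC (tL ord0) tC.
by split=> //; apply: is_numfield_compositum2.
Qed.

(** At each step the field split off is the stable one; the remaining compositum enters as an
    arbitrary number field. *)
Lemma t_is_one_compositum_stable r (L : 'I_r -> cset) :
    (forall i, is_numfield (L i)) -> (forall i, aut_stable (L i)) ->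
    (forall i, t_is_one (L i)) ->
  is_numfield (compositum L) /\ t_is_one (compositum L).
Proof.
elim: r L => [|r IH] L nL stL tL; first by have [] := compositum0 L.
have [|||nC tC] := IH (fun i => L (lift ord0 i)) => //.
rewrite compositumS; split; first exact: is_numfield_compositum2.
exact: t_is_one_compositum2.
Qed.

(** * Quadratic fields *)

Lemma sqrtC_conj (nu : {rmorphism algC -> algC}) (m : int) :
  nu (sqrtC m%:~R) = sqrtC m%:~R \/ nu (sqrtC m%:~R) = - sqrtC m%:~R.
Proof.
suff : nu (sqrtC m%:~R) ^+ 2 == sqrtC m%:~R ^+ 2.
  by rewrite eqf_sqr => /orP[] /eqP; [left | right].
by rewrite -rmorphXn sqrtCK rmorph_int.
Qed.

Lemma quad_field_stable m : aut_stable (quad_field m).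
Proof.
(* Minimality of the generated field is applied to the preimage of [F] under [nu], a subfield that
   contains the square root. *)
move=> nu x gx F subF SF; apply: (gx (fun y => F (nu y))).
  have [F0 F1 FB FM FV] := subF.
  split=> [||y z|y z|y]; rewrite ?rmorph0 ?rmorph1 ?rmorphB ?rmorphM ?fmorphV //.
  - exact: FB.
  - exact: FM.
  by move=> Fy nz; apply: FV; rewrite ?fmorph_eq0.
move=> _ ->; have Fm := SF _ erefl.
by case: (sqrtC_conj nu m) => ->; last apply: subfieldN.
Qed.

Lemma quad_field_t_is_one m : (m %% 4)%Z = 1 ->
  is_numfield (quad_field m) /\ t_is_one (quad_field m).
Proof.
move=> m1; have [M [iota [s eq_s]]] := splitting_model [:: sqrtC m%:~R].
case: s eq_s => [|w [|]] // [iota_w].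
have -> : quad_field m = img iota <<1; w>>%AS.
  rewrite -[RHS]/(img iota <<1; w>>%VS) -adjoin_seq1 -gen_field_img /= iota_w.
  rewrite /quad_field; congr gen_field; apply: cset_eq => x.
  by rewrite inE; split=> [->|/eqP].
split; first exact: is_numfield_img.
apply/t_is_one_img; set K := <<1; w>>%AS.
have Kw : w \in K by apply: memv_adjoin.
(* If [m] is a square the field is Q, and 1 has trace 1. *)
have [Qw|nQw] := boolP (w \in 1%VS).
  have -> : K = 1%AS by apply: val_inj; apply/Fadjoin_idP.
  exists 1; split; rewrite ?mem1v ?rmorph1 //.
  by rewrite -sumr_const; apply: eq_bigr => g _; rewrite rmorph1.
pose a := (1 + w) / 2%:R; have two_neq0 : 2%:R != 0 :> M.
  by rewrite -(rmorph_nat (in_alg M)) fmorph_eq0 pnatr_eq0.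
have H_w (g : gal_of {:M}) : (g \in 'Gal({:M} / K)%g) = (g w == w).
  apply/idP/eqP=> [Hg|gw]; first exact: gal_fix Hg Kw.
  apply: mem_gal => _ /Fadjoin1_polyP[p ->].
  rewrite -horner_map /= gw -map_poly_comp; congr _.[_].
  by apply: eq_map_poly => q; rewrite /= rmorph_alg.
have gal_w (g : gal_of {:M}) : g w = w \/ g w = - w.
  have [nu nu_g] := gal_lift iota g.
  have [] := sqrtC_conj nu m;
    rewrite -iota_w -nu_g -?rmorphN => /fmorph_inj; by [left|right].
(* Otherwise [w] would be fixed by all of [G], hence rational. *)
have [g0 g0w] : exists g0 : gal_of {:M}, g0 w = - w.
  apply: NNPP => no_g0; case/negP: nQw.
  rewrite -[1%VS]/(1%AS : {vspace M}) -(galois_fixedField (galois_fullv 1%AS)).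
  apply/fixedFieldP=> [|g _]; first exact: memvf.
  by case: (gal_w g) => // gw; case: no_g0; exists g.
exists a; split.
- by rewrite rpred_div ?rpredD ?mem1v ?rpred_nat.
(* With [m = 4c + 1], the element [a] is a root of the monic integral polynomial X^2 - X - c. *)
- have def_m := divz_eq m 4; rewrite m1 in def_m; set c := (m %/ 4)%Z in def_m.
  pose s := sqrtC (m%:~R : algC).
  have s2 : s ^+ 2 = c%:~R * 4%:R + 1 by rewrite sqrtCK def_m rmorphD rmorphM.
  have -> : iota a = (1 + s) / 2%:R.
    by rewrite fmorph_div rmorphD rmorph1 rmorph_nat /= iota_w.
  apply: (@root_monic_Aint ('X^2 - ('X + c%:~R%:P))).
  + rewrite rootE !hornerE.
    have -> : ((1 + s) / 2%:R) ^+ 2 - ((1 + s) / 2%:R + c%:~R)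
      = (s ^+ 2 - (c%:~R * 4%:R + 1)) / 4%:R by field.
    by rewrite s2 subrr mul0r.
  + rewrite monicE lead_coefDl ?lead_coefXn ?eqxx //.
    by rewrite size_polyN size_XaddC size_polyXn.
  apply/polyOverP=> i; rewrite coefB coefD coefXn coefX coefC -mulrb.
  by case: (i == 0)%N;
    rewrite ?mulr1n ?mulr0n !(rpredB, rpredD) ?rpred_nat ?rpred_int ?rpred0.
(* H_K has index 2: the elements outside H_K all send w to - w. *)
have cosetC : ~: 'Gal({:M} / K)%g = ('Gal({:M} / K) :* g0)%g.
  apply/setP=> g; rewrite inE H_w; apply/idP/idP=> [gw|/mem_rcoset_gal/(_ w Kw) ->].
    rewrite mem_rcoset H_w galME.
    case: (gal_w g) gw => -> gw; first by rewrite eqxx in gw.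
    by rewrite -g0w -galME mulgV gal_id.
  rewrite g0w eq_sym -subr_eq0 opprK -mulr2n -mulr_natl mulf_neq0 //.
  by apply: contraNneq nQw => ->; rewrite mem0v.
(* Elements of [H K] contribute [a], the equally many others [1 - a], so the total is [#|H K|]. *)
rewrite (bigID (mem 'Gal({:M} / K)%g)) /=.
rewrite (eq_bigr (fun=> a)) => [|g /andP[_ Hg]]; last first.
  apply: gal_fix Hg _.
  by rewrite rpred_div ?rpredD ?mem1v ?rpred_nat.
rewrite [X in _ + X](eq_bigr (fun=> 1 - a)) => [|g /andP[_]]; last first.
  rewrite H_w fmorph_div rmorphD rmorph1 rmorph_nat /=.
  case: (gal_w g) => ->; rewrite ?eqxx // => _.
  by apply: (mulIf two_neq0); rewrite /a; field.
rewrite !sumr_const [X in a *+ X](_ : _ = #|'Gal({:M} / K)%g|); last first.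
  by apply: eq_card => g; rewrite [LHS]unfold_in mem_galQ.
rewrite [X in (1 - a) *+ X](_ : _ = #|~: 'Gal({:M} / K)%g|); last first.
  by apply: eq_card => g; rewrite [LHS]unfold_in mem_galQ -in_setC.
by rewrite cosetC card_rcoset -mulrnDl addrC subrK.
Qed.

Theorem theorem3 :
  (* (I) *)
  (forall (r : nat) (L : 'I_r -> cset),
     (forall i, is_numfield (L i)) ->
     (forall i j, i != j -> coprime (deg (L i)) (deg (L j))) ->
     (forall i, t_is_one (L i)) ->
     deg (compositum L) = (\prod_(i < r) deg (L i))%N /\ t_is_one (compositum L))
  /\
  (* (II) *)
  (forall (r : nat) (m : 'I_r -> int),
     (forall i, squarefree (m i)) ->
     (forall i, (m i %% 4)%Z = 1) ->
     t_is_one (compositum (fun i => quad_field (m i))))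
  /\
  (* (III) *)
  (forall K L : cset,
     is_numfield K -> is_numfield L -> is_normal K -> is_normal L ->
     t_is_one K -> t_is_one L -> t_is_one (compositum2 K L)).
Proof.
split; last split.
- move=> r L nL coL tL.
  by have [_ degL t1] := t_is_one_compositum_coprime nL coL tL.
- move=> r m _ m1; apply: (t_is_one_compositum_stable _ _ _).2 => i.
  + by have [] := quad_field_t_is_one (m1 i).
  + exact: quad_field_stable.
  by have [] := quad_field_t_is_one (m1 i).
(* Any endomorphism of [algC] is an embedding of [K], so normality gives stability. *)
move=> K L nK nL normK _; apply: t_is_one_compositum2 => // nu x Kx.
by have [stK _] := normK nu (is_emb_rmorph K nu); apply: stK.
Qed.
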